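(* If $V$ is a vector space of finite dimension $n$ over a division ring, then the largest subsemilattices (subsemilattices of maximum cardinality) of $\mathrm{End}(V)$ have $2^n$ elements.
   Context: $\mathrm{End}(V)$ is the monoid of all linear maps $V\to V$ under composition. A semilattice is a commutative semigroup all of whose elements are idempotent; a subsemilattice of a monoid is a subsemigroup that is a semilattice. *)

(* Defs.v *)
From HB Require Import structures.
From mathcomp Require Import all_boot all_order all_algebra.
From mathcomp Require Import boolp classical_sets functions cardinality.

Set Implicit Arguments.
Unset Strict Implicit.
Unset Printing Implicit Defensive.

(* (f * g)%g is the composite f \o g; the library's ring structure on 'End(V)
   needs a commutative R and V != 0. *)
HB.instance Definition _ (R : nzRingType) (V : vectType R) :=
  isMonoid.Build 'End(V) (@comp_lfunA R V V V V)
    (@comp_lfun1l R V V) (@comp_lfun1r R V V).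

Section Semilattices.
Local Open Scope group_scope.
Local Open Scope classical_set_scope.
Local Open Scope card_scope.

Variable M : monoidType.
Implicit Types S T : set M.

Definition subsemigroup S := forall x y, S x -> S y -> S (x * y).

Definition subsemilattice S :=
  [/\ subsemigroup S,
      forall x y, S x -> S y -> x * y = y * x
    & forall x, S x -> x * x = x].

(* S and T may be infinite: #<= compares cardinals through injections. *)
Definition largest_subsemilattice S :=
  subsemilattice S /\ forall T, subsemilattice T -> T #<= S.

End Semilattices.

(* Main.v *)
Require Import Defs.
From HB Require Import structures.
From mathcomp Require Import all_boot all_order all_algebra.
From mathcomp Require Import boolp classical_sets functions cardinality.

(** Take an orthogonal family of nonzero idempotents with sum 1, commuting with
    every element of a semilattice S, and with as many members as possible; over
    a division ring it has k <= n members, since nonzero vectors in their images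
    are linearly independent.  By commutativity of S, each s in S would split a
    member e into e s and e (1 - s); maximality forces e s to be 0 or e, so s is
    the sum of a subfamily, and S has at most 2^k elements.  The diagonal 0-1
    matrices reach 2^n. *)

Set Implicit Arguments.
Unset Strict Implicit.

Import GRing.Theory.
Local Open Scope ring_scope.
Local Open Scope classical_set_scope.
Local Open Scope card_scope.

(** Gaussian elimination on the first column, by induction on the number of columns: a nonzero entry
    serves as pivot to clear the others, and a zero column is dropped. Scalars act on rows from the
    left, as [D] need not commute. *)
Lemma left_kernel_neq0 (D : unitRingType)
    (divD : forall x : D, x != 0 -> x \is a GRing.unit)
    (n k : nat) (A : 'M[D]_(k, n)) :
  (n < k)%N -> exists2 c : 'rV[D]_k, c != 0 & c *m A = 0.
Proof.
elim: n k A => [|n IHn] [|k] A // ltnk.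
  exists (const_mx 1); last by apply/matrixP => i [].
  by apply/eqP => /matrixP/(_ 0 0)/eqP; rewrite !mxE oner_eq0.
have [/existsP[i a_neq0]|/existsPn col0] := boolP [exists i, A i 0 != 0].
  pose B := \matrix_(l, j)
    (A (lift i l) j - A (lift i l) 0 * (A i 0)^-1 * A i j).
  have [c c_neq0 cB] := IHn k (col' 0 B) ltnk.
  have {}cB : c *m B = 0.
    apply/rowP => j; have [j' ->|->] := unliftP 0 j.
      move/rowP/(_ j'): cB; rewrite !mxE; apply: etrans.
      by apply: eq_bigr => l _; rewrite !mxE.
    rewrite !mxE big1 // => l _; rewrite !mxE.
    by rewrite mulrVK ?divD // subrr mulr0.
  (* The entry at the pivot row [i] collects the multiples of that row subtracted in [B], so that
     the new combination of rows of [A] equals [c *m B]. *)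
  exists (\row_j if unlift i j is Some l then c 0 l
                 else - \sum_l c 0 l * (A (lift i l) 0 * (A i 0)^-1)).
    apply: contra_neq c_neq0 => /rowP c'0; apply/rowP => l.
    by have := c'0 (lift i l); rewrite !mxE liftK.
  apply/rowP => j; move/rowP/(_ j): cB => <-.
  rewrite !mxE (bigD1_ord i) //= !mxE unlift_none mulNr big_distrl /= addrC.
  rewrite -sumrB; apply: eq_bigr => l _.
  by rewrite !mxE liftK mulrBr !mulrA.
have [c c_neq0 cA] := IHn _ (col' 0 A) (ltnW ltnk).
exists c => //; apply/rowP => j; have [j' ->|->] := unliftP 0 j.
  move/rowP/(_ j'): cA; rewrite !mxE; apply: etrans.
  by apply: eq_bigr => l _; rewrite mxE.
by rewrite !mxE big1 // => i _; rewrite (eqP (negbNE (col0 i))) mulr0.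
Qed.

Definition orthogonal_idempotents (A : pzRingType) (es : seq A) :=
  [/\ uniq es, 0 \notin es
    & {in es &, forall e f, e * f = if e == f then e else 0}].

(** A nonzero row of each member is fixed by that member and killed by the others under right
    multiplication. More than [n] such rows would satisfy a relation, and multiplying it by a member
    isolates one coefficient. *)
Lemma size_orthogonal_idempotents (D : unitRingType)
    (divD : forall x : D, x != 0 -> x \is a GRing.unit)
    (n : nat) (es : seq 'M[D]_n) :
  orthogonal_idempotents es -> (size es <= n)%N.
Proof.
case=> es_uniq es0 es_mul; rewrite leqNgt; apply/negP => lt_n.
have es_in (i : 'I_(size es)) : es`_i \in es by rewrite mem_nth.
have mul_es (i j : 'I_(size es)) :
    es`_i *m es`_j = if i == j then es`_i else 0.
  by apply: etrans (es_mul _ _ (es_in i) (es_in j)) _; rewrite nth_uniq.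
have /choice[r r_neq0] (i : 'I_(size es)) : exists r, row r es`_i != 0.
  apply/existsP; apply: contraNT es0 => /existsPn rows0.
  suff <- : es`_i = 0 by [].
  by apply/row_matrixP => r; rewrite (eqP (negbNE (rows0 r))) row0.
pose X := \matrix_i row (r i) es`_i.
have [c c_neq0 cX] := left_kernel_neq0 divD X lt_n.
case/eqP: c_neq0; apply/rowP => i; rewrite mxE; apply/eqP.
apply: contraNT (r_neq0 i) => c_i.
have : c *m X *m es`_i = 0 by rewrite cX mul0mx.
rewrite [c *m X]mulmx_sum_row mulmx_suml (bigD1 i) //= big1 ?addr0 => [|j j_neq_i].
  rewrite -scalemxAl rowK -row_mul mul_es eqxx => /(congr1 ( *:%R (c 0 i)^-1)).
  by rewrite scalerA mulVr ?divD // scale1r scaler0 => ->.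
by rewrite -scalemxAl rowK -row_mul mul_es (negPf j_neq_i) row0 scaler0.
Qed.

Lemma orthogonal_idempotents_cons (A : pzRingType) (e : A) (es : seq A) :
    orthogonal_idempotents es -> e != 0 -> e * e = e ->
    (forall f, f \in es -> e * f = 0 /\ f * e = 0) ->
  orthogonal_idempotents (e :: es).
Proof.
move=> [es_uniq es0 es_mul] e_neq0 ee e_es.
have e_notin : e \notin es.
  by apply: contraNN e_neq0 => /e_es[]; rewrite ee => ->.
split=> [/=|/[!inE]|f g /[!inE] /predU1P[->|f_in] /predU1P[->|g_in]].
- by rewrite e_notin.
- by rewrite eq_sym negb_or e_neq0.
- by rewrite eqxx.
- by rewrite eq_sym (negPf (memPn e_notin _ g_in)); have [] := e_es _ g_in.
- by rewrite (negPf (memPn e_notin _ f_in)); have [] := e_es _ f_in.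
- exact: es_mul.
Qed.

Lemma card_setT_sets (n : nat) : [set: {set 'I_n}] #= `I_(2 ^ n)%N.
Proof.
have <- : #|{set 'I_n}| = (2 ^ n)%N by rewrite -cardsT -powersetT card_powerset cardsT card_ord.
rewrite (card_eqr card_II).
rewrite -(card_eql (inj_card_eq (in2W (@enum_rank_inj {set 'I_n})))).
suff -> : range (@enum_rank {set 'I_n}) = [set: _] by exact: card_eqxx.
by apply/seteqP; split=> // x _; exists (enum_val x); rewrite ?enum_valK.
Qed.

(** Matrices enter only through the bound on orthogonal families, so the count is made in any ring,
    including the zero ring, which ['M_0] is. *)
Lemma card_commuting_idempotents (A : pzRingType) (n : nat) (S : set A) :
    (forall es : seq A, orthogonal_idempotents es -> (size es <= n)%N) ->
    (forall x y, S x -> S y -> x * y = y * x) ->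
    (forall x, S x -> x * x = x) ->
  S #<= `I_(2 ^ n)%N.
Proof.
move=> size_le S_comm S_idem.
pose P es := [/\ orthogonal_idempotents es, \sum_(e <- es) e = 1
               & forall e s, e \in es -> S s -> e * s = s * e].
have exP : exists k, `[< exists2 es, size es = k & P es >].
  (* In the zero ring [[:: 1]] would contain 0, so the starting family is the empty one, whose sum 0
     equals 1. *)
  have [one0|one_neq0] := eqVneq (1 : A) 0.
    exists 0; apply/asboolP; exists [::] => //.
    by split=> //; rewrite big_nil one0.
  exists 1; apply/asboolP; exists [:: 1] => //; split.
  - split=> //; first by rewrite inE eq_sym.
    by move=> e f /[!inE] /eqP-> /eqP->; rewrite eqxx mulr1.
  - by rewrite big_seq1.
  - by move=> e s /[!inE] /eqP->; rewrite mul1r mulr1.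
have ubP k : `[< exists2 es, size es = k & P es >] -> (k <= n)%N.
  by move=> /asboolP[es <- [/size_le]].
case: (ex_maxnP exP ubP) => k /asboolP[es <- {k}] Pes max_es.
case: (Pes) => -[es_uniq es0 es_mul] es_sum es_comm.
have corner_dichotomy s e : S s -> e \in es -> e * s = 0 \/ e * s = e.
  move=> Ss e_in; have ee : e * e = e by rewrite es_mul ?eqxx.
  have es_e := es_comm _ _ e_in Ss; have ss := S_idem _ Ss.
  (* The identities below make [f] and [g] orthogonal idempotents with sum [e]. *)
  set f := e * s; set g := e - f.
  have ef : e * f = f by rewrite mulrA ee.
  have fe : f * e = f by rewrite /f -mulrA -es_e ef.
  have ff : f * f = f by rewrite {2}/f mulrA fe -mulrA ss.
  have fg : f * g = 0 by rewrite mulrBr fe ff subrr.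
  have gf : g * f = 0 by rewrite mulrBl ef ff subrr.
  have gg : g * g = g by rewrite {1}/g mulrBl fg subr0 mulrBr ee ef.
  have [->|f_neq0] := eqVneq f 0; first by left.
  have [/eqP|g_neq0] := eqVneq g 0; first by rewrite subr_eq0 => /eqP; right.
  have orth_rem : orthogonal_idempotents (rem e es).
    split=> [||h1 h2 /mem_rem h1_in /mem_rem h2_in]; first exact: rem_uniq.
      by apply: contraNN es0 => /mem_rem.
    exact: es_mul.
  (* What is orthogonal to [e] is orthogonal to both pieces, since [f] is [s * e] as well as
     [e * s]. *)
  have [f_rem g_rem] : (forall h, h \in rem e es -> f * h = 0 /\ h * f = 0) /\
                       (forall h, h \in rem e es -> g * h = 0 /\ h * g = 0).
    apply: all_and2 => h; apply: all_and2; rewrite mem_rem_uniq //.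
    move=> /andP[/= h_neq h_in].
    have eh : e * h = 0 by rewrite es_mul // eq_sym (negPf h_neq).
    have he : h * e = 0 by rewrite es_mul // (negPf h_neq).
    have fh : f * h = 0 by rewrite /f es_e -mulrA eh mulr0.
    have hf : h * f = 0 by rewrite /f mulrA he mul0r.
    by rewrite mulrBl mulrBr eh he fh hf subrr.
  (* Trading [e] for two nonzero pieces lengthens the family by one, against maximality. *)
  suff /max_es : `[< exists2 fs, size fs = (size es).+1 & P fs >].
    by rewrite ltnn.
  apply/asboolP; exists [:: f, g & rem e es].
    by rewrite /= size_rem // prednK // -has_predT; apply/hasP; exists e.
  (* Commutativity of [S] keeps the refined family commuting with all of [S]. *)
  have f_comm t : S t -> f * t = t * f.
    move=> St; rewrite /f -mulrA (S_comm s t) // mulrA (es_comm e t) //.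
    by rewrite -mulrA.
  split.
  - apply: orthogonal_idempotents_cons => //.
      exact: orthogonal_idempotents_cons.
    by move=> h /[!inE] /predU1P[->|/f_rem].
  - by rewrite !big_cons addrA [f + g]addrC subrK -[RHS]es_sum [RHS](big_rem e).
  - move=> h t /[!inE] /predU1P[->|/predU1P[->|/mem_rem h_in]] St.
    + exact: f_comm.
    + by rewrite mulrBl mulrBr f_comm // es_comm.
    + exact: es_comm.
pose F (X : {set 'I_(size es)}) := \sum_(i in X) es`_i.
have S_sub : S `<=` range F.
  (* Since the members sum to 1, [s] is the sum of the products [es]_i *
     s[, each of which is 0 or the nonzero]es[_i]. *)
  move=> s Ss; exists (finset (fun i : 'I_(size es) => es`_i * s != 0)) => //.
  rewrite -[RHS]mul1r -es_sum (big_nth 0) big_mkord big_distrl /=.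
  rewrite /F big_mkcond /=; apply: eq_bigr => i _; rewrite inE.
  have [->|->] := corner_dichotomy s es`_i Ss (mem_nth _ (ltn_ord i)).
    by rewrite eqxx.
  by rewrite ifT //; apply: contraNneq es0 => <-; apply: mem_nth.
have := size_le es; move=> /(_ (And3 es_uniq es0 es_mul)) size_es.
apply: (card_le_trans (subset_card_le S_sub)).
apply: (card_le_trans (card_image_le _ _)).
apply: (@card_le_trans _ _ _ `I_(2 ^ size es)%N); last first.
  by rewrite card_le_II leq_exp2l.
by have := card_setT_sets (size es); rewrite card_eq_le => /andP[].
Qed.

Import VectorInternalTheory.

(** The factors are swapped because matrices act on row vectors from the right. *)
Lemma f2mx_comp (R : nzSemiRingType) (V : semiVectType R) (f g : 'End(V)) :
  f2mx (f \o g)%VF = f2mx g *m f2mx f.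
Proof.
apply/row_matrixP => i; rewrite !rowE /comp_lfun unlock /= mul_rV_lin1 /=.
by rewrite unlock /= !r2vK mulmxA.
Qed.

Lemma f2mx_inj (R : nzSemiRingType) (V : semiVectType R) :
  injective (@f2mx R V V).
Proof. exact: val_inj. Qed.

(** Passing to matrices reverses products, which preserves commutation and idempotency; injectivity
    preserves cardinality. *)
Lemma card_subsemilattice_le (D : unitRingType)
    (divD : forall x : D, x != 0 -> x \is a GRing.unit)
    (V : vectType D) (S : set 'End(V)) :
  subsemilattice S -> S #<= `I_(2 ^ dim V)%N.
Proof.
move=> [_ S_comm S_idem].
rewrite -(card_le_eql (inj_card_eq (in2W (@f2mx_inj _ V)))).
apply: card_commuting_idempotents.
- exact: size_orthogonal_idempotents.
- move=> _ _ [f Sf <-] [g Sg <-].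
  by rewrite -[LHS]f2mx_comp -[RHS]f2mx_comp; congr f2mx; exact: S_comm.
- by move=> _ [f Sf <-]; rewrite -[LHS]f2mx_comp; congr f2mx; exact: S_idem.
Qed.

(** The projection onto the coordinates in [X] along the others, in the coordinates that the
    structure of [V] carries. *)
Definition diag_lfun (R : nzSemiRingType) (V : semiVectType R)
  (X : {set 'I_(dim V)}) : 'End(V) := Hom (diag_mx (\row_i (i \in X)%:R)).

Lemma diag_lfun_inj (R : nzSemiRingType) (V : semiVectType R) :
  injective (@diag_lfun R V).
Proof.
move=> X Y [/matrixP eqXY]; apply/setP => i.
have := eqXY i i; rewrite !mxE eqxx !mulr1n.
by case: (i \in X) (i \in Y) => -[] //= /eqP;
  rewrite mulr1n mulr0n ?oner_eq0 // eq_sym oner_eq0.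
Qed.

Lemma comp_diag_lfun (R : nzSemiRingType) (V : semiVectType R)
    (X Y : {set 'I_(dim V)}) :
  (diag_lfun X \o diag_lfun Y)%VF = diag_lfun (X :&: Y).
Proof.
apply: f2mx_inj; rewrite f2mx_comp mulmx_diag; congr diag_mx.
by apply/rowP => i; rewrite !mxE inE -natrM mulnb andbC.
Qed.

Lemma subsemilattice_diag (R : nzRingType) (V : vectType R) :
  subsemilattice (range (@diag_lfun R V)).
Proof.
split=> [_ _ [X _ <-] [Y _ <-]|_ _ [X _ <-] [Y _ <-]|_ [X _ <-]].
- by exists (X :&: Y) => //; rewrite -comp_diag_lfun.
- by apply: etrans (comp_diag_lfun _ _) _; rewrite finset.setIC -comp_diag_lfun.
- by apply: etrans (comp_diag_lfun _ _) _; rewrite finset.setIid.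
Qed.

Lemma card_diag (R : nzSemiRingType) (V : semiVectType R) :
  range (@diag_lfun R V) #= `I_(2 ^ dim V)%N.
Proof.
rewrite (card_eql (inj_card_eq (in2W (@diag_lfun_inj R V)))).
exact: card_setT_sets.
Qed.

Unset Implicit Arguments.
Set Strict Implicit.

(** Existence is asserted too, so that the cardinality claim is not vacuous. *)
Theorem corollary1p2 (D : unitRingType)
    (divD : forall x : D, x != 0 -> x \is a GRing.unit)
    (n : nat) (V : vectType D) (dimV : dim V = n) :
  (exists S : set 'End(V), largest_subsemilattice S) /\
  (forall S : set 'End(V), largest_subsemilattice S -> S #= `I_(2 ^ n)%N).
Proof.
subst n; split=> [|S [S_lat S_max]].
  exists (range (@diag_lfun D V)); split=> [|T T_lat].
    exact: subsemilattice_diag.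
  by rewrite (card_le_eqr (card_diag V)); exact: card_subsemilattice_le.
(* The general bound gives one inequality; comparing [S] with the diagonal family gives the
   other. *)
rewrite card_eq_le card_subsemilattice_le //=.
by rewrite -(card_le_eql (card_diag V)); exact/S_max/subsemilattice_diag.
Qed.
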